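(* Let $K$ be an infinite field of arbitrary characteristic, let $m,n\ge 0$ with $m+n\geq 1$, $r\ge 1$, and let $V$ be the natural $GL(m|n)$-supermodule over $K$. Then the Schur superalgebra $S(m|n,r)$ is isomorphic to $$\mathrm{End}_{K\Sigma_r}(V^{\otimes r})^{op},$$ the isomorphism being the one given by the map $\Psi_r$; that is, $\Psi_r$ is surjective onto $\mathrm{End}_{K\Sigma_r}(V^{\otimes r})^{op}$.
   Context: Parities: $|j|=0$ for $1\le j\le m$ and $|j|=1$ for $m+1\le j\le m+n$. $V$ has basis $v_1,\dots,v_{m+n}$ with $v_j$ of parity $|j|$. For a multi-index $I=(i_1,\dots,i_r)$ with entries in $\{1,\dots,m+n\}$, $v_I=v_{i_1}\otimes\cdots\otimes v_{i_r}$. The symmetric group $\Sigma_r$ acts on $V^{\otimes r}$ on the right by $(v_I)\tau_j=(-1)^{|i_j||i_{j+1}|}v_{I.(j,j+1)}$ for $\tau_j=(j,j+1)$, $1\le j<r$, where $I.(j,j+1)$ is $I$ with its $j$th and $(j+1)$st entries exchanged. $G=GL(m|n)$ is the general linear supergroup over $K$; its coordinate superalgebra $K[G]$ is generated by the entries $c_{ij}$ ($1\le i,j\le m+n$, $|c_{ij}|=|i|+|j|$) of the generic matrix $C$ and the entries $d_{ij}$ of $C^{-1}$, where supercommutativity means $ab=(-1)^{|a||b|}ba$ for homogeneous $a,b$. $Dist(G)$ is its distribution algebra: the linear functionals on $K[G]$ vanishing on some power of the augmentation ideal, with convolution product. $Dist(G)$ acts on $V$ and on $V^{\otimes r}$ from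 the left via the $G$-supermodule structure; the matrix units $e_{ij}\in Dist_1(G)$, of parity $|e_{ij}|=|i|+|j|$, act by $e_{ij}v_k=\delta_{jk}v_i$ and $$e_{ij}.v_I=\sum_{a=1}^r\delta_{j i_a}(-1)^{|e_{ij}|(|i_1|+\cdots+|i_{a-1}|)}v_{i_1}\otimes\cdots\otimes v_i\otimes\cdots\otimes v_{i_r}$$ ($v_i$ in position $a$). The two actions commute, and $\Psi_r: Dist(G)\to \mathrm{End}_{K\Sigma_r}(V^{\otimes r})^{op}$ denotes the induced map sending an element to the operator by which it acts. $\mathrm{End}_{K\Sigma_r}(V^{\otimes r})$ is the space of all $K$-linear endomorphisms (not only parity-preserving ones) of $V^{\otimes r}$ commuting with the operators by which $\Sigma_r$ acts. The Schur superalgebra $S(m|n,r)$ is by definition the image of $Dist(G)$ in $\mathrm{End}_K(V^{\otimes r})$. The superscript $op$ is a convention about the order of composition; surjectivity of $\Psi_r$ means that, as subspaces of $\mathrm{End}_K(V^{\otimes r})$, $S(m|n,r)$ equals $\mathrm{End}_{K\Sigma_r}(V^{\otimes r})$. *)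

(* Defs.v *)
From HB Require Import structures.
From mathcomp Require Import all_boot all_order all_algebra all_fingroup.
From mathcomp Require Import boolp classical_sets cardinality.
From mathcomp Require Import zify ring.
From mathcomp Require Import generic_quotient ring_quotient monalg.
Set Implicit Arguments.
Unset Strict Implicit.
Unset Printing Implicit Defensive.
Import GRing.Theory.
Local Open Scope ring_scope.
Local Open Scope quotient_scope.
Local Open Scope classical_set_scope.

(** * Two-sided ideals of a noncommutative ring *)

Inductive ideal_gen (A : nzRingType) (S : A -> Prop) : A -> Prop :=
| ideal_gen0 : ideal_gen S 0
| ideal_genS a s b x : S s -> ideal_gen S x -> ideal_gen S (a * s * b + x).

(* The k-th power I^k; it is the whole ring for k = 0. *)
Definition ideal_pow (A : nzRingType) (I : A -> Prop) (k : nat) : A -> Prop :=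
  ideal_gen (fun x => exists2 s : 'I_k -> A,
    (forall i, I (s i)) & x = \prod_(i < k) s i).

Section IdealGenTheory.
Variables (A : nzRingType) (S : A -> Prop).

Lemma ideal_gen_incl s : S s -> ideal_gen S s.
Proof.
move=> Ss; rewrite -[s]mul1r -[1 * s]mulr1 -[_ * 1]addr0.
by apply: ideal_genS => //; apply: ideal_gen0.
Qed.

Lemma ideal_genD x y : ideal_gen S x -> ideal_gen S y -> ideal_gen S (x + y).
Proof.
move=> Ix Iy; elim: Ix => [|a s b z Ss _ IH]; first by rewrite add0r.
by rewrite -addrA; apply: ideal_genS.
Qed.

Lemma ideal_genM a x b : ideal_gen S x -> ideal_gen S (a * x * b).
Proof.
elim=> [|a' s b' z Ss _ IH]; first by rewrite mulr0 mul0r; apply: ideal_gen0.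
rewrite mulrDr mulrDl !mulrA -(mulrA (a * a' * s)).
exact: ideal_genS.
Qed.

Lemma ideal_genMl a x : ideal_gen S x -> ideal_gen S (a * x).
Proof. by move=> Ix; rewrite -[a * x]mulr1; apply: ideal_genM. Qed.

Lemma ideal_genMr x b : ideal_gen S x -> ideal_gen S (x * b).
Proof. by move=> Ix; rewrite -[x]mul1r; apply: ideal_genM. Qed.

Definition in_ideal_gen : pred A := fun x => `[< ideal_gen S x >].

Lemma in_ideal_genP x : reflect (ideal_gen S x) (x \in in_ideal_gen).
Proof. exact: asboolP. Qed.

Fact in_ideal_gen_zmod_closed : zmod_closed in_ideal_gen.
Proof.
split=> [|x y /in_ideal_genP Ix /in_ideal_genP Iy]; apply/in_ideal_genP.
  exact: ideal_gen0.
by apply: ideal_genD => //; rewrite -mulN1r; apply: ideal_genMl.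
Qed.

HB.instance Definition _ :=
  GRing.isZmodClosed.Build A in_ideal_gen in_ideal_gen_zmod_closed.

End IdealGenTheory.

Lemma malg_scaleAr (M : monomType) (R : comNzRingType) (k : R)
    (x y : {malg R[M]}) : k *: (x * y) = x * (k *: y).
Proof.
apply/malgP=> w; rewrite mcoeffZ.
rewrite (mcoeffMlw _ (finmap.fsubset_refl _) (finmap.fsubset_refl _)).
rewrite (mcoeffMlw _ (finmap.fsubset_refl _) (msuppZ_le _ _)).
rewrite mulr_sumr; apply: eq_bigr => k1 _.
rewrite mulr_sumr; apply: eq_bigr => k2 _.
by rewrite mcoeffZ mulrnAr mulrCA.
Qed.

(** * The coordinate superalgebra of GL(m|n) *)

Section CoordinateAlgebra.
Variables (K : fieldType) (m n : nat).

(* Indices are 0-based: the even ones are those below m. *)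
Definition par (i : 'I_(m + n)) : bool := (m <= i)%N.

(* [inl (i, j)] stands for the entry c_ij of the generic matrix C, and
   [inr (i, j)] for the entry d_ij of its inverse. *)
Definition gl_gen : choiceType :=
  (('I_(m + n) * 'I_(m + n)) + ('I_(m + n) * 'I_(m + n)))%type.

Definition gl_idx (x : gl_gen) : 'I_(m + n) * 'I_(m + n) :=
  match x with inl p => p | inr p => p end.

Definition gl_par (x : gl_gen) : bool := par (gl_idx x).1 (+) par (gl_idx x).2.

Definition gl_free := {malg K[{fmonom gl_gen}]}.
HB.instance Definition _ := GRing.Lalgebra.on gl_free.

Definition gl_var (x : gl_gen) : gl_free := mkmalgU (fmu x) 1.

(* Supercommutativity is imposed on generators, which implies it for all
   homogeneous elements.  It does not include x^2 = 0 for odd x: this follows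
   from [gl_scomm] when the characteristic is not 2, and is not required in
   characteristic 2, where the algebra is the commutative K[GL_(m+n)]. *)
Inductive gl_rel : gl_free -> Prop :=
| gl_scomm x y : gl_rel (gl_var x * gl_var y
    - (-1) ^+ (gl_par x && gl_par y) * (gl_var y * gl_var x))
| gl_CD i j : gl_rel
    (\sum_k gl_var (inl (i, k)) * gl_var (inr (k, j)) - (i == j)%:R)
| gl_DC i j : gl_rel
    (\sum_k gl_var (inr (i, k)) * gl_var (inl (k, j)) - (i == j)%:R).

Definition gl_ideal : zmodClosed gl_free :=
  GRing.ZmodClosed.clone _ (in_ideal_gen gl_rel) _.

(* The counit of the free algebra, sending c_ij and d_ij to the Kronecker
   delta; it factors through the quotient. *)
Definition word_counit (w : {fmonom gl_gen}) : K :=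
  \prod_(x <- (w : seq gl_gen)) ((gl_idx x).1 == (gl_idx x).2)%:R.

Fact word_counit_mmorphism : mmorphism word_counit.
Proof.
split=> [x y|]; rewrite /word_counit; last by rewrite fm1 big_nil.
by rewrite /mul /= fmmulE big_cat.
Qed.

HB.instance Definition _ :=
  monalg.isMultiplicative.Build _ _ word_counit word_counit_mmorphism.

Definition free_counit : gl_free -> K := mmap idfun word_counit.
HB.instance Definition _ := GRing.LRMorphism.copy free_counit (mmap idfun word_counit).

Lemma free_counit_var x :
  free_counit (gl_var x) = ((gl_idx x).1 == (gl_idx x).2)%:R.
Proof. by rewrite /free_counit mmapU mul1r /word_counit fmuE big_seq1. Qed.

Lemma free_counit_rel x : gl_rel x -> free_counit x = 0.
Proof.
case=> [{}x y|i j|i j].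
- rewrite rmorphB (rmorphM _ (gl_var x)) (rmorphM _ (_ ^+ _)).
  rewrite (rmorph_sign free_counit) (rmorphM _ (gl_var y)) /= !free_counit_var.
  rewrite /gl_par; case: eqP => [->|_]; last by rewrite !(mulr0, mul0r) subr0.
  by rewrite addbb /= expr0 !(mul1r, mulr1) subrr.
- rewrite rmorphB rmorph_sum rmorph_nat (bigD1 i) //= big1 => [|k /negPf ki].
    by rewrite rmorphM /= !free_counit_var /= eqxx mul1r addr0 subrr.
  by rewrite rmorphM /= !free_counit_var /= eq_sym ki mul0r.
- rewrite rmorphB rmorph_sum rmorph_nat (bigD1 i) //= big1 => [|k /negPf ki].
    by rewrite rmorphM /= !free_counit_var /= eqxx mul1r addr0 subrr.
  by rewrite rmorphM /= !free_counit_var /= eq_sym ki mul0r.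
Qed.

Lemma free_counit_ideal x : x \in gl_ideal -> free_counit x = 0.
Proof.
move/in_ideal_genP; elim=> [|a s b y /free_counit_rel s0 _ y0].
  by rewrite rmorph0.
by rewrite rmorphD !rmorphM /= s0 y0 mulr0 mul0r addr0.
Qed.

Definition gl_coord := Quotient.quot gl_ideal.
HB.instance Definition _ := GRing.Zmodule.on gl_coord.
HB.instance Definition _ := EqQuotient.on gl_coord.
HB.instance Definition _ := ZmodQuotient.on gl_coord.

Definition gl_pi (x : gl_free) : gl_coord := \pi_gl_coord x.
Definition gl_repr (x : gl_coord) : gl_free := repr x.

Lemma gl_reprK : cancel gl_repr gl_pi.
Proof. exact: reprK. Qed.

Lemma gl_coord_eq (x y : gl_free) :
  (gl_pi x == gl_pi y) = (x - y \in gl_ideal).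
Proof. by rewrite -Quotient.idealrBE. Qed.

Definition gl_one : gl_coord := gl_pi 1.
Definition gl_mul (x y : gl_coord) : gl_coord := gl_pi (gl_repr x * gl_repr y).
Definition gl_scale (k : K) (x : gl_coord) : gl_coord := gl_pi (k *: gl_repr x).

Fact gl_reprB (x : gl_free) : gl_repr (gl_pi x) - x \in gl_ideal.
Proof. by rewrite -gl_coord_eq gl_reprK. Qed.

Fact gl_pi_mul x y : gl_mul (gl_pi x) (gl_pi y) = gl_pi (x * y).
Proof.
apply/eqP; rewrite gl_coord_eq.
set x' := gl_repr _; set y' := gl_repr _.
have -> : x' * y' - x * y = (x' - x) * y' + x * (y' - y).
  by rewrite mulrBl mulrBr addrA subrK.
by apply: rpredD; apply/in_ideal_genP;
  [apply: ideal_genMr|apply: ideal_genMl]; apply/in_ideal_genP/gl_reprB.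
Qed.

Fact gl_pi_scale k x : gl_scale k (gl_pi x) = gl_pi (k *: x).
Proof.
apply/eqP; rewrite gl_coord_eq -scalerBr -[_ - x]mul1r scalerAl.
by apply/in_ideal_genP/ideal_genMl/in_ideal_genP/gl_reprB.
Qed.

Lemma gl_pi_add x y : gl_pi (x + y) = gl_pi x + gl_pi y.
Proof. by rewrite !piE. Qed.

Lemma gl_coord_ind (P : gl_coord -> Prop) : (forall x, P (gl_pi x)) -> forall x, P x.
Proof. by move=> Px x; rewrite -[x]gl_reprK. Qed.

Fact gl_mulA : associative gl_mul.
Proof.
by elim/gl_coord_ind=> x; elim/gl_coord_ind=> y; elim/gl_coord_ind=> z;
  rewrite !gl_pi_mul mulrA.
Qed.

Fact gl_mul1 : left_id gl_one gl_mul.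
Proof. by elim/gl_coord_ind=> x; rewrite gl_pi_mul mul1r. Qed.

Fact gl_mulx1 : right_id gl_one gl_mul.
Proof. by elim/gl_coord_ind=> x; rewrite gl_pi_mul mulr1. Qed.

Fact gl_mulDl : left_distributive gl_mul +%R.
Proof.
by elim/gl_coord_ind=> x; elim/gl_coord_ind=> y; elim/gl_coord_ind=> z;
  rewrite -gl_pi_add !gl_pi_mul -gl_pi_add mulrDl.
Qed.

Fact gl_mulDr : right_distributive gl_mul +%R.
Proof.
by elim/gl_coord_ind=> x; elim/gl_coord_ind=> y; elim/gl_coord_ind=> z;
  rewrite -gl_pi_add !gl_pi_mul -gl_pi_add mulrDr.
Qed.

Fact gl_one_neq0 : gl_one != 0.
Proof.
have -> : 0 = gl_pi 0 by rewrite !piE.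
rewrite gl_coord_eq subr0; apply/negP => /free_counit_ideal.
by rewrite rmorph1 => /eqP; rewrite oner_eq0.
Qed.

HB.instance Definition _ :=
  GRing.Zmodule_isNzRing.Build gl_coord gl_mulA gl_mul1 gl_mulx1 gl_mulDl gl_mulDr gl_one_neq0.

Fact gl_scaleA a b v : gl_scale a (gl_scale b v) = gl_scale (a * b) v.
Proof. by elim/gl_coord_ind: v => v; rewrite !gl_pi_scale scalerA. Qed.

Fact gl_scale1 : left_id 1 gl_scale.
Proof. by elim/gl_coord_ind=> v; rewrite gl_pi_scale scale1r. Qed.

Fact gl_scaleDr : right_distributive gl_scale +%R.
Proof.
by move=> k; elim/gl_coord_ind=> x; elim/gl_coord_ind=> y;
  rewrite -gl_pi_add !gl_pi_scale -gl_pi_add scalerDr.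
Qed.

Fact gl_scaleDl v : {morph gl_scale^~ v : a b / a + b}.
Proof. by elim/gl_coord_ind: v => v a b; rewrite !gl_pi_scale -gl_pi_add scalerDl. Qed.

HB.instance Definition _ :=
  GRing.Zmodule_isLmodule.Build K gl_coord gl_scaleA gl_scale1 gl_scaleDr gl_scaleDl.

Fact gl_scaleAl (k : K) (x y : gl_coord) : k *: (x * y) = k *: x * y.
Proof.
elim/gl_coord_ind: x => x; elim/gl_coord_ind: y => y.
by rewrite /GRing.mul /GRing.scale /= gl_pi_mul !gl_pi_scale gl_pi_mul -scalerAl.
Qed.

HB.instance Definition _ := GRing.Lmodule_isLalgebra.Build K gl_coord gl_scaleAl.

Fact gl_scaleAr (k : K) (x y : gl_coord) : k *: (x * y) = x * (k *: y).
Proof.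
elim/gl_coord_ind: x => x; elim/gl_coord_ind: y => y.
by rewrite /GRing.mul /GRing.scale /= gl_pi_mul !gl_pi_scale gl_pi_mul malg_scaleAr.
Qed.

HB.instance Definition _ := GRing.Lalgebra_isAlgebra.Build K gl_coord gl_scaleAr.


Fact gl_pi_nmod : nmod_morphism gl_pi.
Proof. by split=> [|x y]; [rewrite /gl_pi piE|exact: gl_pi_add]. Qed.
HB.instance Definition _ :=
  GRing.isNmodMorphism.Build gl_free gl_coord gl_pi gl_pi_nmod.

Fact gl_pi_monoid : monoid_morphism gl_pi.
Proof. by split=> [|x y]; [exact: erefl|exact: esym (gl_pi_mul x y)]. Qed.
HB.instance Definition _ :=
  GRing.isMonoidMorphism.Build gl_free gl_coord gl_pi gl_pi_monoid.

Fact gl_pi_scalable : scalable gl_pi.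
Proof. by move=> k x; rewrite -gl_pi_scale. Qed.
HB.instance Definition _ :=
  GRing.isScalable.Build K gl_free gl_coord *:%R gl_pi gl_pi_scalable.

Definition gl_c i j : gl_coord := gl_pi (gl_var (inl (i, j))).
Definition gl_d i j : gl_coord := gl_pi (gl_var (inr (i, j))).

Lemma gl_pi_rel x : gl_rel x -> gl_pi x = 0.
Proof.
move=> rx; rewrite -[0](rmorph0 gl_pi); apply/eqP; rewrite gl_coord_eq subr0.
by apply/in_ideal_genP/ideal_gen_incl.
Qed.

Lemma gl_cM i j k l : gl_c i j * gl_c k l =
  (-1) ^+ ((par i (+) par j) && (par k (+) par l)) * (gl_c k l * gl_c i j).
Proof.
have /gl_pi_rel/eqP := gl_scomm (inl (i, j)) (inl (k, l)).
rewrite rmorphB (rmorphM _ (gl_var _)) (rmorphM _ (_ ^+ _)).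
by rewrite (rmorph_sign gl_pi) (rmorphM _ (gl_var _)) subr_eq0 => /eqP.
Qed.

Lemma gl_cd i j : \sum_k gl_c i k * gl_d k j = (i == j)%:R.
Proof.
have /gl_pi_rel/eqP := gl_CD i j.
rewrite rmorphB rmorph_sum rmorph_nat subr_eq0 => /eqP <-.
by apply: eq_bigr => k _; rewrite rmorphM.
Qed.

Lemma gl_dc i j : \sum_k gl_d i k * gl_c k j = (i == j)%:R.
Proof.
have /gl_pi_rel/eqP := gl_DC i j.
rewrite rmorphB rmorph_sum rmorph_nat subr_eq0 => /eqP <-.
by apply: eq_bigr => k _; rewrite rmorphM.
Qed.

(** * Counit, augmentation ideal and distributions *)

Definition gl_counit (x : gl_coord) : K := free_counit (gl_repr x).

Lemma gl_counit_pi x : gl_counit (gl_pi x) = free_counit x.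
Proof.
apply/eqP; rewrite -subr_eq0 -rmorphB; apply/eqP/free_counit_ideal.
exact: gl_reprB.
Qed.

Fact gl_counit_nmod : nmod_morphism gl_counit.
Proof.
split=> [|x y]; first by rewrite -(rmorph0 gl_pi) gl_counit_pi rmorph0.
elim/gl_coord_ind: x => x; elim/gl_coord_ind: y => y.
by rewrite -rmorphD !gl_counit_pi rmorphD.
Qed.
HB.instance Definition _ :=
  GRing.isNmodMorphism.Build gl_coord K gl_counit gl_counit_nmod.

Fact gl_counit_monoid : monoid_morphism gl_counit.
Proof.
split=> [|x y]; first by rewrite -(rmorph1 gl_pi) gl_counit_pi rmorph1.
elim/gl_coord_ind: x => x; elim/gl_coord_ind: y => y.
by rewrite -rmorphM !gl_counit_pi rmorphM.
Qed.
HB.instance Definition _ :=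
  GRing.isMonoidMorphism.Build gl_coord K gl_counit gl_counit_monoid.

Fact gl_counit_scalable : scalable_for *%R gl_counit.
Proof.
move=> k x; elim/gl_coord_ind: x => x.
by rewrite -linearZ !gl_counit_pi linearZ.
Qed.
HB.instance Definition _ :=
  GRing.isScalable.Build K gl_coord K *%R gl_counit gl_counit_scalable.

Lemma gl_counit_c i j : gl_counit (gl_c i j) = (i == j)%:R.
Proof. by rewrite gl_counit_pi free_counit_var. Qed.

Lemma gl_counit_d i j : gl_counit (gl_d i j) = (i == j)%:R.
Proof. by rewrite gl_counit_pi free_counit_var. Qed.

Definition gl_aug (x : gl_coord) : Prop := gl_counit x = 0.

(* The underlying space of Dist(G): its convolution product does not enter the
   definition of the operators [Psi phi]. *)
Definition gl_dist : set {scalar gl_coord} :=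
  [set phi | exists k, forall x, ideal_pow gl_aug k x -> phi x = 0].

End CoordinateAlgebra.

Arguments gl_dist K m n : clear implicits.
Arguments par {m n} i.
Arguments gl_c K {m n} i j.
Arguments gl_d K {m n} i j.

(** * Tensor powers of the natural supermodule *)

Section TensorPower.
Variables (K : fieldType) (m n r : nat).

Definition midx := {ffun 'I_r -> 'I_(m + n)}.

(* V^{\otimes r} is modelled by coordinates in the basis of the v_I. *)
Definition tens := {ffun midx -> K^o}.
HB.instance Definition _ := Vector.on tens.

Definition tvec (I : midx) : tens := [ffun J => (J == I)%:R].

Definition lin_ext_fun (F : midx -> tens) (w : tens) : tens :=
  \sum_I (w I : K) *: F I.

Fact lin_ext_fun_linear F : linear (lin_ext_fun F).
Proof.
move=> k u v; rewrite /lin_ext_fun scaler_sumr -big_split /=.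
by apply: eq_bigr => I _; rewrite !ffunE scalerDl scalerA.
Qed.
HB.instance Definition _ F := GRing.isLinear.Build K tens tens *:%R
  (lin_ext_fun F) (lin_ext_fun_linear F).

(* The linear endomorphism sending v_I to F I. *)
Definition lin_ext (F : midx -> tens) : 'End(tens) := linfun (lin_ext_fun F).

Lemma lin_ext_tvec F I : lin_ext F (tvec I) = F I.
Proof.
rewrite lfunE /= /lin_ext_fun (bigD1 I) //= big1 => [|J /negPf JI].
  by rewrite ffunE eqxx scale1r addr0.
by rewrite ffunE JI scale0r.
Qed.

Lemma tens_sum (w : tens) : w = \sum_I (w I : K) *: tvec I.
Proof.
apply/ffunP=> J; rewrite sum_ffunE (bigD1 J) //= big1 => [|I /negPf JI].
  by rewrite !ffunE eqxx addr0 /GRing.scale /= mulr1.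
by rewrite !ffunE eq_sym JI /GRing.scale /= mulr0.
Qed.

Lemma eq_lin_tvec (f g : 'End(tens)) :
  (forall I, f (tvec I) = g (tvec I)) -> f = g.
Proof.
move=> fg; apply/lfunP=> w; rewrite [w]tens_sum !linear_sum /=.
by apply: eq_bigr => I _; rewrite !linearZ /= fg.
Qed.

(** ** The right action of the symmetric group *)

(* Since (s * t) x = t (s x) for permutations in MathComp, moving the entry in
   place a to place s a is a right action. *)
Definition midx_perm (I : midx) (s : 'S_r) : midx := [ffun a => I ((s^-1)%g a)].

(* A sign for each pair of odd entries whose order is reversed. *)
Definition perm_sign (I : midx) (s : 'S_r) : K :=
  \prod_(a < r) \prod_(b < r | (a < b)%N && (s b < s a)%N)
    (-1) ^+ (par (I a) && par (I b)).

Definition sym_op (s : 'S_r) : 'End(tens) :=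
  lin_ext (fun I => perm_sign I s *: tvec (midx_perm I s)).

Lemma perm_signM I s t :
  perm_sign I (s * t)%g = perm_sign I s * perm_sign (midx_perm I s) t.
Proof.
pose e a b : K := (-1) ^+ (par (I a) && par (I b)).
have e_sym a b : e a b = e b a by rewrite /e andbC.
have e2 a b : e a b * e a b = 1 by rewrite -expr2 sqrr_sign.
pose f a b : K := if (s a < s b)%N && (t (s b) < t (s a))%N then e a b else 1.
have -> : perm_sign (midx_perm I s) t = \prod_(a < r) \prod_(b < r) f a b.
  rewrite /perm_sign (reindex_inj (@perm_inj _ s)) /=; apply: eq_bigr => a _.
  rewrite big_mkcond /= (reindex_inj (@perm_inj _ s)) /=; apply: eq_bigr => b _.
  by rewrite !ffunE !permK.
have -> : \prod_(a < r) \prod_(b < r) f a b =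
    \prod_(a < r) \prod_(b < r | (a < b)%N) (f a b * f b a).
  under [RHS]eq_bigr => a _ do rewrite big_split.
  rewrite big_split /= [X in _ * X](exchange_big_dep predT) //= -big_split /=.
  apply: eq_bigr => a _; rewrite (bigID (fun b : 'I_r => (a < b)%N)) /=.
  congr (_ * _); rewrite big_mkcond [RHS]big_mkcond; apply: eq_bigr => b _ /=.
  by case: ltngtP => //= /val_inj ->; rewrite /f ltnn.
rewrite /perm_sign -big_split; apply: eq_bigr => a _ /=.
rewrite big_mkcondr [X in _ = X * _]big_mkcondr -big_split /=.
apply: eq_bigr => b ab; rewrite !permM -/(e a b) /f (e_sym b a).
have sab : (s a == s b) = false.
  by rewrite (inj_eq perm_inj); apply: contraTF ab => /eqP->; rewrite ltnn.
have tab : (t (s a) == t (s b)) = false by rewrite (inj_eq perm_inj).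
case: (ltngtP (s a) (s b)) => [_|_|/val_inj/eqP]; last by rewrite sab.
  by rewrite /= mul1r mulr1.
case: (ltngtP (t (s a)) (t (s b))) => [_|_|/val_inj/eqP]; last by rewrite tab.
  by rewrite /= mul1r e2.
by rewrite /= !mulr1.
Qed.

Lemma sym_op1 : sym_op 1%g = \1%VF.
Proof.
apply: eq_lin_tvec => I; rewrite lin_ext_tvec id_lfunE /perm_sign.
rewrite big1 ?scale1r => [|a _].
  by congr tvec; apply/ffunP=> a; rewrite ffunE invg1 perm1.
rewrite big1 // => b; rewrite !perm1.
by case: ltngtP.
Qed.

Lemma sym_opM s t w : sym_op (s * t)%g w = sym_op t (sym_op s w).
Proof.
rewrite -comp_lfunE; congr (fun_of_lfun _ w); apply: eq_lin_tvec => I.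
rewrite comp_lfunE !lin_ext_tvec linearZ /= lin_ext_tvec scalerA perm_signM.
by congr (_ *: tvec _); apply/ffunP=> a; rewrite !ffunE invMg permM.
Qed.

Lemma sym_op_transp (I : midx) (a b : 'I_r) : b = a.+1 :> nat ->
  sym_op (tperm a b) (tvec I) =
    (-1 : K) ^+ (par (I a) && par (I b)) *: tvec [ffun k => I (tperm a b k)].
Proof.
move=> ab; have neq_ab : a != b by rewrite -val_eqE /= ab neq_ltn ltnSn.
rewrite lin_ext_tvec; congr (_ *: tvec _); last first.
  by apply/ffunP=> k; rewrite !ffunE tpermV.
have inv_ab (x y : 'I_r) :
    (x < y)%N && (tperm a b y < tperm a b x)%N = (x == a) && (y == b).
  rewrite !permE /= -!val_eqE /=.
  case: (nat_of_ord y =P a) => ya; case: (nat_of_ord y =P b) => yb;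
    case: (nat_of_ord x =P a) => xa; case: (nat_of_ord x =P b) => xb /=; lia.
rewrite /perm_sign (bigD1 a) //= [X in _ * X]big1 ?mulr1 => [|x /negPf xa].
  by under eq_bigl => y do rewrite inv_ab eqxx; rewrite big_pred1_eq.
by rewrite big_pred0 // => y; rewrite inv_ab xa.
Qed.

(* End_{K Sigma_r}(V^{\otimes r}), with all linear endomorphisms allowed, not
   only the even ones; its opposite algebra has the same underlying subspace of
   End_K(V^{\otimes r}). *)
Definition End_sym : set 'End(tens) :=
  [set f | forall s : 'S_r, (f \o sym_op s)%VF = (sym_op s \o f)%VF].

(** ** The action of the distribution algebra *)

Definition midx_par (I : midx) : bool := odd (\sum_(a < r) par (I a)).

(* The coefficients of the coaction: v_J |-> \sum_I v_I \otimes tcoef I J.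
   For r = 1 this is v_j |-> \sum_i v_i \otimes c_ij; in general the sign comes
   from moving each c_(i_a j_a) to the right past the v_(i_b) with b > a. *)
Definition tcoef (I J : midx) : gl_coord K m n :=
  (\prod_(a < r) \prod_(b < r | (a < b)%N)
     (-1) ^+ ((par (I a) (+) par (J a)) && par (I b)))
  *: \prod_(a < r) gl_c K (I a) (J a).

(* A functional phi acts through id \otimes phi after the coaction, with the
   Koszul sign (-1)^(|phi| |I|) for moving phi past v_I.  Only the component of
   phi of parity |tcoef I J| = |I| + |J| contributes to phi (tcoef I J). *)
Definition Psi (phi : {scalar gl_coord K m n}) : 'End(tens) :=
  lin_ext (fun J => \sum_I
    ((-1) ^+ (midx_par I && (midx_par I (+) midx_par J)) * phi (tcoef I J))
      *: tvec I).

(* The Schur superalgebra S(m|n, r), the image of Dist(G). *)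
Definition schur : set 'End(tens) := Psi @` gl_dist K m n.

End TensorPower.

Arguments End_sym K m n r : clear implicits.
Arguments schur K m n r : clear implicits.

(** ** The action of the matrix units *)

Section MatrixUnit.
Variables (K : fieldType) (m n r : nat).
Variables (phi : {scalar gl_coord K m n}) (i j : 'I_(m + n)).

Let pe := par i (+) par j.

(* e_ij is the superderivation at the counit which is dual to c_ij; its value
   at c_ij is normalized by e_ij v_j = v_i. *)
Hypothesis phi_der : forall x y,
  phi (x * y) = phi x * gl_counit y + gl_counit x * phi y.
Hypothesis phi_c : forall k l,
  phi (gl_c K k l) = (-1) ^+ (par i && pe) * ((k == i) && (l == j))%:R.

Let phi1 : phi 1 = 0.
Proof.
have := phi_der 1 1; rewrite mulr1 rmorph1 mulr1 mul1r => /eqP.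
by rewrite -subr_eq0 opprD addrA subrr sub0r oppr_eq0 => /eqP.
Qed.

Let phi_prod (s : seq 'I_r) (F : 'I_r -> gl_coord K m n) : uniq s ->
  phi (\prod_(a <- s) F a) =
    \sum_(a <- s) phi (F a) * \prod_(b <- s | b != a) gl_counit (F b).
Proof.
elim: s => [|a s IH] /=; first by rewrite !big_nil phi1.
move=> /andP[nas us]; rewrite !big_cons phi_der (IH us) eqxx /=.
rewrite rmorph_prod mulr_sumr; congr (_ * _ + _).
  rewrite [RHS]big_seq_cond [LHS]big_seq; apply: eq_bigl => b.
  by case: eqP => [->|_]; rewrite ?andbT ?andbF // (negPf nas).
rewrite [LHS]big_seq [RHS]big_seq; apply: eq_bigr => b bs.
rewrite big_cons; have -> : a != b by apply: contraNneq nas => ->.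
by rewrite mulrCA.
Qed.

Definition midx_set (J : midx m n r) (a : 'I_r) (k : 'I_(m + n)) : midx m n r :=
  [ffun b => if b == a then k else J b].

Let sgn_midx_par (I : midx m n r) (b : bool) :
  (-1) ^+ (midx_par I && b) = \prod_(a < r) (-1) ^+ (par (I a) && b) :> K.
Proof.
rewrite /midx_par; elim/big_ind2: _ => [//|x1 y1 x2 y2|a _]; last by rewrite oddb.
by rewrite oddD andb_addl signr_addb => -> ->.
Qed.

Let tcoefE (I J : midx m n r) : phi (tcoef K I J) = \sum_(a < r)
  (\prod_(a < r) \prod_(b < r | (a < b)%N)
     (-1) ^+ ((par (I a) (+) par (J a)) && par (I b))) *
  ((-1) ^+ (par i && pe) * ((I == midx_set J a i) && (J a == j))%:R).
Proof.
rewrite linearZ /= phi_prod ?index_enum_uniq // mulr_sumr.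
apply: eq_bigr => a _; congr (_ * _); rewrite phi_c -mulrA; congr (_ * _).
have [Ia|Ia] := eqVneq (I a) i; last first.
  rewrite mul0r; case: eqP => // IJ; move: Ia.
  by rewrite IJ ffunE eqxx eqxx.
rewrite [in RHS]andbC; case: (J a == j); last by rewrite mul0r.
rewrite mul1r andTb.
have [->|IJ] := eqVneq I (midx_set J a i).
  by rewrite big1 // => b /negPf ba; rewrite gl_counit_c ffunE ba eqxx.
have /existsP[b /negP Jb] : [exists b, I b != midx_set J a i b].
  apply: contraNT IJ => /existsPn eIJ; apply/eqP/ffunP=> b.
  by apply/eqP; have := eIJ b; rewrite negbK.
have ba : b != a by apply: contra_not_neq Jb => ->; rewrite ffunE eqxx Ia.
rewrite (bigD1 b) //= gl_counit_c; move: Jb; rewrite ffunE (negPf ba).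
by case: eqP => // _; rewrite mul0r.
Qed.

Lemma Psi_matrix_unit (J : midx m n r) :
  Psi r phi (tvec K J) = \sum_(a < r | J a == j)
    (\prod_(b < r | (b < a)%N) (-1) ^+ (pe && par (J b)) : K)
      *: tvec K (midx_set J a i).
Proof.
rewrite lin_ext_tvec.
under eq_bigr => I _ do rewrite tcoefE mulr_sumr scaler_suml.
rewrite exchange_big [RHS]big_mkcond; apply: eq_bigr => a _ /=.
rewrite (bigD1 (midx_set J a i)) //= [X in _ + X]big1 ?addr0; last first.
  by move=> I /negPf->; rewrite /= !mulr0 scale0r.
rewrite eqxx /=; case: eqP => [Ja|_]; last by rewrite !mulr0 scale0r.
congr (_ *: _); rewrite mulr1; set I := midx_set J a i.
have par_pe : midx_par I (+) midx_par J = pe.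
  rewrite /midx_par -oddD -big_split /=.
  rewrite (bigD1 a) //= ffunE eqxx Ja oddD oddD !oddb.
  suff -> : odd (\sum_(b < r | b != a) (par (I b) + par (J b))) = false.
    by rewrite addbF.
  elim/big_ind: _ => // [x y|b /negPf ba]; first by rewrite oddD => -> ->.
  by rewrite ffunE ba addnn odd_double.
rewrite par_pe sgn_midx_par (bigD1 a) //= [in RHS]/pe.
have -> : \prod_(a0 < r) \prod_(b < r | (a0 < b)%N)
     (-1) ^+ ((par (I a0) (+) par (J a0)) && par (I b)) =
     \prod_(b < r | (a < b)%N) (-1) ^+ (pe && par (J b)) :> K.
  rewrite (bigD1 a) //= [X in _ * X]big1 ?mulr1 => [|c /negPf ca].
    apply: eq_bigr => b ab; rewrite !ffunE eqxx Ja -/pe.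
    by case: eqP ab => // ->; rewrite ltnn.
  by rewrite big1 // => b _; rewrite ffunE ca addbb.
rewrite ffunE eqxx.
have -> : \prod_(b < r | b != a) (-1) ^+ (par (I b) && pe) =
     \prod_(b < r | b != a) (-1) ^+ (pe && par (J b)) :> K.
  by apply: eq_bigr => b /negPf ba; rewrite ffunE ba andbC.
set u := (-1) ^+ (par i && pe); set v := \prod_(b < r | b != a) _.
set w := \prod_(b < r | (a < b)%N) _.
have -> : v = w * \prod_(b < r | (b < a)%N) (-1) ^+ (pe && par (J b)).
  rewrite /v (bigID (fun b : 'I_r => (a < b)%N)) /=; congr (_ * _);
    apply: eq_bigl => b; rewrite -val_eqE /=; lia.
have uu : u * u = 1 by rewrite -expr2 sqrr_sign.
have ww : w * w = 1 by rewrite /w -big_split big1 //= => b _; rewrite -expr2 sqrr_sign.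
rewrite -[RHS]mul1r -uu -[u * u]mulr1 -ww /pe; ring.
Qed.

End MatrixUnit.

(* Main.v *)
Require Import Defs.
From mathcomp Require Import all_boot all_order all_algebra.
From mathcomp Require Import boolp classical_sets cardinality.
From HB Require Import structures.
From mathcomp Require Import fingroup perm.
From mathcomp Require Import zify.
From mathcomp Require Import monalg.
Set Implicit Arguments.
Unset Strict Implicit.
Unset Printing Implicit Defensive.
Import GRing.Theory.

(** Write an operator on the tensor power in the basis of the v_I, so that its
    coefficients are indexed by pairs (I, J), that is, by words of r letters
    (i_k, j_k).  The operator of a distribution phi has as its coefficient at
    (I, J) a Koszul sign times phi (c_{i_1 j_1} ... c_{i_r j_r})
    ([Psi_coef]).  On the other side, an operator commutes with the symmetric
    group if and only if its coefficients at two words that differ by the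
    exchange of two adjacent letters agree up to an explicit sign ([End_symP]).
    After removal of the Koszul signs, this sign is the one of
    supercommutativity for the two letters ([koszul_sign_swap]).  Thus the
    operators that commute with the symmetric group correspond to the
    supersymmetric functions g on words of length r, and supercommutativity of
    K[G] shows that the operators of distributions are among them
    ([schur_sub_End_sym]).

    For the converse, each such g must be extended from the monomials of degree
    r in the c_ij to a linear form on K[G] that vanishes on a power of the
    augmentation ideal ([super_form_distribution]).  Work near the identity:
    put C = 1 + X with X a generic matrix, and discard all terms of degree
    greater than r in X.  Then C is invertible, with inverse the truncated
    geometric series, so the substitution is a morphism from K[G] to the
    quotient of the tensor algebra on the x_ij by the supercommutators and by
    the elements of degree greater than r ([gl_subst_rel]).  It maps the
    augmentation ideal into positive degree, hence kills the power r + 1 of that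
    ideal.  The linear form is the substitution followed by the form that
    applies g to the component of degree r; supersymmetry of g says precisely
    that the latter form descends to the quotient ([top_form_ideal]).  Since the
    component of degree r of the product of the factors
    c_{i_k j_k} = delta + x_{i_k j_k} is the product of the x_{i_k j_k}
    ([prod_word_leading]), the value at c_{i_1 j_1} ... c_{i_r j_r} is g, with no
    correction from lower degrees. *)

Local Open Scope ring_scope.

(** * Supercommutation modulo a two-sided ideal *)

(** Stated over arbitrary rings, like the identities on products below: the
    multiplication of a concrete monoid algebra unfolds to a sum, which
    rewriting inside its terms would expose. *)
Lemma rmorph_mul_prod (R R' : nzRingType) (f : {rmorphism R -> R'}) k a
    (F : 'I_k -> R) b :
  f (a * (\prod_i F i) * b) = f a * (\prod_i f (F i)) * f b.
Proof. by rewrite !rmorphM rmorph_prod. Qed.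

Lemma rmorph_super_commutator (R R' : nzRingType) (f : {rmorphism R -> R'})
    (b : bool) x y :
  f (x * y - (-1) ^+ b * (y * x)) = f x * f y - (-1) ^+ b * (f y * f x).
Proof. by rewrite rmorphB !rmorphM rmorph_sign. Qed.

Section SuperCommutation.
Variables (A : nzRingType) (S : A -> Prop).

(** The booleans [d] and [e] are formal parities: they are not read off from
    [x] and [y], so that [0] and the entries of the identity matrix may be
    given whichever parity their position requires. *)
Definition super_comm (d : bool) (x : A) (e : bool) (y : A) : Prop :=
  ideal_gen S (x * y - (-1) ^+ (d && e) * (y * x)).

Lemma super_commC d x e y : super_comm d x e y -> super_comm e y d x.
Proof.
move=> /(ideal_genMl (- (-1) ^+ (d && e))); rewrite /super_comm.
by rewrite mulrBr !mulNr opprK signrMK addrC andbC.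
Qed.

Lemma super_comm0 d e y : super_comm d 0 e y.
Proof. by rewrite /super_comm mul0r !mulr0 subr0; apply: ideal_gen0. Qed.

Lemma super_commD d x x' e y :
  super_comm d x e y -> super_comm d x' e y -> super_comm d (x + x') e y.
Proof.
move=> xy x'y; rewrite /super_comm mulrDl !mulrDr opprD addrACA.
exact: ideal_genD.
Qed.

Lemma super_comm_sum (I : Type) (s : seq I) (F : I -> A) d e y :
  (forall i, super_comm d (F i) e y) -> super_comm d (\sum_(i <- s) F i) e y.
Proof.
move=> Fy; elim/big_rec: _ => [|i x _]; first exact: super_comm0.
exact: super_commD.
Qed.

Lemma super_commN d x e y : super_comm d x e y -> super_comm d (- x) e y.
Proof.
move=> /(ideal_genMl (-1)); rewrite /super_comm.
by rewrite mulN1r opprB !mulNr !mulrN opprK addrC.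
Qed.

Lemma super_comm1 e y : super_comm false 1 e y.
Proof.
by rewrite /super_comm /= expr0 !mul1r mulr1 subrr; apply: ideal_gen0.
Qed.

(** Supercommutation with a fixed [y] passes to products, parities adding up:
    this is why it is enough to impose it on generators. *)
Lemma super_commM d x d' x' e y : super_comm d x e y -> super_comm d' x' e y ->
  super_comm (d (+) d') (x * x') e y.
Proof.
move=> xy x'y; rewrite /super_comm andb_addl signr_addb.
have -> : x * x' * y - (-1) ^+ (d && e) * (-1) ^+ (d' && e) * (y * (x * x')) =
    x * (x' * y - (-1) ^+ (d' && e) * (y * x')) +
    (-1) ^+ (d' && e) * (x * y - (-1) ^+ (d && e) * (y * x)) * x'.
  rewrite !mulrBr mulrBl.
  (* Signs are central, so the two middle terms cancel. *)
  have -> : x * ((-1) ^+ (d' && e) * (y * x')) = (-1) ^+ (d' && e) * (x * y) * x'.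
    by rewrite mulrA commr_sign -!mulrA.
  rewrite addrA subrK; congr (_ - _); first by rewrite mulrA.
  by rewrite -signr_addb addbC signr_addb -!mulrA.
by apply: ideal_genD; [apply: ideal_genMl|apply: ideal_genM].
Qed.

End SuperCommutation.

(** * The tensor algebra and its truncated supersymmetric quotient *)

Section Multilinear.
Variables (K : fieldType) (A : algType K).
Implicit Types (c : K) (u s v x y : A).

Lemma linear_mul_left c u x s v :
  (c *: u + x) * s * v = c *: (u * s * v) + x * s * v.
Proof. by rewrite !mulrDl -!scalerAl. Qed.

Lemma linear_mul_right c u s v y :
  u * s * (c *: v + y) = c *: (u * s * v) + u * s * y.
Proof. by rewrite !mulrDr -!scalerAr. Qed.

Lemma mul_commutator (b : bool) u x y v :
  u * (x * y - (-1) ^+ b * (y * x)) * v =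
  u * x * y * v - (-1) ^+ b *: (u * y * x * v).
Proof.
rewrite mulrBr mulrBl; congr (_ - _); first by rewrite !mulrA.
by case: b; rewrite ?expr1 ?expr0 ?scale1r ?mul1r ?scaleN1r ?mulN1r ?mulrN ?mulNr !mulrA.
Qed.

End Multilinear.

Section TruncatedFree.
Variables (K : fieldType) (T : finType) (p : T -> bool) (r : nat).

(** A name of its own gives the free algebra on [T] an algebra structure that
    unification finds without unfolding the monoid of words. *)
Definition tens_alg := {malg K[{fmonom T}]}.
HB.instance Definition _ := GRing.Lalgebra.on tens_alg.
Local Notation P := tens_alg.

Fact tens_alg_scaleAr (k : K) (x y : P) : k *: (x * y) = x * (k *: y).
Proof. exact: malg_scaleAr. Qed.
HB.instance Definition _ :=
  GRing.Lalgebra_isAlgebra.Build K tens_alg tens_alg_scaleAr.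

Definition word (w : seq T) : P := << FMonom w >>.

Lemma word_nil : word [::] = 1.
Proof. by rewrite /word -fmoneE. Qed.

Lemma word_cat u v : word (u ++ v) = word u * word v.
Proof. by rewrite malgM_def fgmulUU mulr1 /mul /= fmmulE. Qed.

Lemma tens_alg_ind (Q : P -> Prop) : Q 0 ->
  (forall c w x, Q x -> Q (c *: word w + x)) -> forall x, Q x.
Proof.
move=> Q0 QD x; rewrite [x]monalgE.
elim/big_rec: _ => // w y _ /(QD x@_w w); rewrite (_ : _ *: _ = << x@_w *g w >>) //.
by apply/malgP=> v; rewrite mcoeffZ !mcoeffU mulr_natr.
Qed.

Definition order_ge k (x : P) :=
  forall w : {fmonom T}, (size w < k)%N -> x@_w = 0.

Lemma order_ge0 x : order_ge 0 x. Proof. by []. Qed.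

Lemma order_geN k x : order_ge k x -> order_ge k (- x).
Proof. by move=> xk w wk; rewrite mcoeffN xk // oppr0. Qed.

Lemma order_ge_sum (I : Type) (s : seq I) (F : I -> P) k :
  (forall i, order_ge k (F i)) -> order_ge k (\sum_(i <- s) F i).
Proof. by move=> Fk w wk; rewrite raddf_sum big1 //= => i _; apply: Fk. Qed.

Lemma order_geM j k x y :
  order_ge j x -> order_ge k y -> order_ge (j + k) (x * y).
Proof.
move=> xj yk w wjk; rewrite mcoeffMl big1 // => u _; rewrite big1 // => v _.
case: eqP => [uv|]; last by rewrite mulr0n.
have [uj|ju] := ltnP (size u) j; first by rewrite xj // mul0r.
have [vk|kv] := ltnP (size v) k; first by rewrite yk // mulr0.
by move: wjk; rewrite -uv fmM size_cat ltnNge leq_add.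
Qed.

Lemma order_ge_prod (k : nat) (F : 'I_k -> P) :
  (forall i, order_ge 1 (F i)) -> order_ge k (\prod_i F i).
Proof.
elim: k F => [|k IHk] F F1; first exact: order_ge0.
by rewrite big_ord_recl; apply: (order_geM (F1 ord0) (IHk _ _)) => i.
Qed.

Lemma order_ge_mul_prod (k : nat) (F : 'I_k -> P) x y :
  (forall i, order_ge 1 (F i)) -> order_ge k (x * (\prod_i F i) * y).
Proof.
move=> /order_ge_prod Fk.
by have := order_geM (order_geM (order_ge0 x) Fk) (order_ge0 y); rewrite addn0.
Qed.

Lemma order_ge_word w : order_ge (size w) (word w).
Proof.
move=> v vw; rewrite mcoeffU; case: eqP => // wv.
by move: vw; rewrite -wv ltnn.
Qed.

Definition order_lt k (x : P) :=
  forall w : {fmonom T}, (k <= size w)%N -> x@_w = 0.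

Lemma order_ltD k x y : order_lt k x -> order_lt k y -> order_lt k (x + y).
Proof. by move=> xk yk w kw; rewrite mcoeffD xk // yk // addr0. Qed.

Lemma order_lt_word w : order_lt (size w).+1 (word w).
Proof.
move=> v wv; rewrite mcoeffU; case: eqP => // vw.
by move: wv; rewrite -vw ltnn.
Qed.

Lemma order_ltM j k x y :
  order_lt j.+1 x -> order_lt k y -> order_lt (j + k) (x * y).
Proof.
move=> xj yk w wjk; rewrite mcoeffMl big1 // => u _; rewrite big1 // => v _.
case: eqP => [uv|]; last by rewrite mulr0n.
have [ju|uj] := leqP j.+1 (size u); first by rewrite xj // mul0r.
have [kv|vk] := leqP k (size v); first by rewrite yk // mulr0.
move: wjk; rewrite -uv fmM size_cat leqNgt -addnS.
by rewrite (leq_add (uj : (size u <= j)%N) vk).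
Qed.

Lemma order_lt_nat_mul (b : bool) k x : order_lt k x -> order_lt k (b%:R * x).
Proof.
by case: b => xk; rewrite ?mul1r // mul0r => w _; rewrite mcoeff0.
Qed.

Lemma order_ltW k x : order_lt k x -> order_lt k.+1 x.
Proof. by move=> xk w kw; apply/xk/ltnW. Qed.

(** Taking [e x] to be the value of the counit, the left-hand side is a
    monomial in the entries of [1 + X], with [X] generic: its component of top
    degree is the same monomial in the entries of [X]. *)
Lemma prod_word_leading (e : T -> bool) (s : seq T) : exists2 z,
  order_lt (size s) z & \prod_(x <- s) ((e x)%:R + word [:: x]) = word s + z.
Proof.
elim: s => [|x s [z zs IHs]].
  by exists 0 => [w _|]; rewrite ?mcoeff0 // big_nil addr0 word_nil.
exists ((e x)%:R * (word s + z) + word [:: x] * z) => /=.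
  apply: order_ltD.
    by apply: order_lt_nat_mul; apply: order_ltD; [exact: order_lt_word|apply: order_ltW].
  exact: (order_ltM (order_lt_word (w := [:: x]))).
by rewrite big_cons IHs mulrDl (mulrDr (word [:: x])) -(word_cat [:: x]) /= addrCA.
Qed.

(** The counit of the tensor algebra, under a name of its own that carries the
    structure of a ring morphism. *)
Definition const_coef (x : P) : K := x@_(mone : {fmonom T}).

Fact const_coef_nmod : nmod_morphism const_coef.
Proof. by split=> [|x y]; rewrite /const_coef ?mcoeff0 ?mcoeffD. Qed.
HB.instance Definition _ := GRing.isNmodMorphism.Build P K const_coef const_coef_nmod.

Fact const_coef_monoid : monoid_morphism const_coef.
Proof.
by have [M1 M2] := mcoeff1g_is_multiplicative (fmonom T) K; split.
Qed.
HB.instance Definition _ := GRing.isMonoidMorphism.Build P K const_coef const_coef_monoid.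

Lemma const_coefZ c x : const_coef (c *: x) = c * const_coef x.
Proof. exact: mcoeffZ. Qed.

Lemma const_coef0_order x : const_coef x = 0 -> order_ge 1 x.
Proof.
move=> x0 w; rewrite ltnS leqn0 => /nilP w0; rewrite -[RHS]x0; congr (_@_ _).
by apply: val_inj; rewrite /= fm1.
Qed.

Lemma const_coef_order x : order_ge 1 x -> const_coef x = 0.
Proof. by apply; rewrite fm1. Qed.

(** Defining relations of the supersymmetric algebra on [T], truncated beyond
    degree [r].  Linear forms on this quotient are all that is needed below, so
    it is enough to know generators of the ideal. *)
Inductive trunc_rel : P -> Prop :=
| trunc_scomm x y : trunc_rel (word [:: x] * word [:: y]
    - (-1) ^+ (p x && p y) * (word [:: y] * word [:: x]))
| trunc_high z : order_ge r.+1 z -> trunc_rel z.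

Definition top_form (g : seq T -> K) (x : P) : K :=
  \sum_(t : r.-tuple T) x@_(FMonom t) * g t.

Section TopForm.
Variable g : seq T -> K.

Fact top_form_linear : scalar (top_form g).
Proof.
move=> k x y; rewrite /top_form mulr_sumr -big_split /=.
by apply: eq_bigr => t _; rewrite mcoeffD mcoeffZ mulrDl mulrA.
Qed.
HB.instance Definition _ :=
  GRing.isLinear.Build K P K *%R (top_form g) top_form_linear.

Lemma top_form_word w : top_form g (word w) = if size w == r then g w else 0.
Proof.
rewrite /top_form; case: eqP => [wr|nwr]; last first.
  rewrite big1 // => t _; rewrite mcoeffU; case: eqP => [[wt]|]; last by rewrite mul0r.
  by case: nwr; rewrite wt size_tuple.
pose t0 : r.-tuple T := Tuple (introT eqP wr).
rewrite (bigD1 t0) //= mcoeffUU mul1r big1 ?addr0 // => t /eqP nt.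
rewrite mcoeffU; case: eqP => [[wt]|]; last by rewrite mul0r.
by case: nt; apply: val_inj.
Qed.

Lemma top_form_high z : order_ge r.+1 z -> top_form g z = 0.
Proof.
by move=> zr; rewrite /top_form big1 // => t _; rewrite zr ?mul0r //= size_tuple.
Qed.

Lemma top_form_low z : order_lt r z -> top_form g z = 0.
Proof.
by move=> zr; rewrite /top_form big1 // => t _; rewrite zr ?mul0r //= size_tuple.
Qed.

(** Outside characteristic 2, this forces [g] to vanish at the words with two
    equal odd letters side by side, as the square of an odd element does. *)
Hypothesis g_swap : forall u v x y, size (u ++ x :: y :: v) = r ->
  g (u ++ x :: y :: v) = (-1) ^+ (p x && p y) * g (u ++ y :: x :: v).

(** The form descends to the truncated quotient: the generators of the ideal
    that are supercommutators only need to be tested between two words, where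
    the claim is [g_swap]. *)
Lemma top_form_ideal z : ideal_gen trunc_rel z -> top_form g z = 0.
Proof.
elim=> [|a s b x rel_s _ IH]; first by rewrite linear0.
rewrite linearD /= IH addr0; case: {IH} rel_s => [{}x y|{x} z zr]; last first.
  apply: top_form_high; rewrite -[r.+1]addn0; apply: order_geM => //.
  by rewrite -[r.+1]add0n; apply: order_geM.
elim/tens_alg_ind: a => [|c u a IHa]; first by rewrite !mul0r linear0.
rewrite linear_mul_left linearP [X in _ + X]IHa addr0 {IHa} /=.
set t := top_form _ _; suff -> : t = 0 by rewrite mulr0.
rewrite {}/t; elim/tens_alg_ind: b => [|d v b IHb].
  by rewrite mulr0 linear0.
rewrite linear_mul_right linearP [X in _ + X]IHb addr0 {IHb} /=.
set t := top_form _ _; suff -> : t = 0 by rewrite mulr0.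
rewrite {}/t mul_commutator linearB linearZ /=.
rewrite -!word_cat !top_form_word !size_cat /= -!catA /=.
case: eqP => sz; last by rewrite mulr0 subr0.
by rewrite g_swap ?subrr // -sz size_cat /= !addn1 !addSn !addnS.
Qed.
End TopForm.
End TruncatedFree.

(** * Substituting 1 + X for the generic matrix *)

Lemma mx_subr1 (R : nzRingType) k (M : 'M[R]_k) i j :
  (1 - M) i j - (i == j)%:R = - M i j.
Proof. by rewrite !mxE addrAC subrr add0r. Qed.

Section TruncatedPoint.
Variables (K : fieldType) (m n r : nat).
Let T : finType := ('I_(m + n) * 'I_(m + n))%type.
Definition idx_par (x : 'I_(m + n) * 'I_(m + n)) : bool := par x.1 (+) par x.2.
Local Notation P := (tens_alg K T).
Local Notation rel := (trunc_rel (K := K) idx_par r).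

Definition gen_mx : 'M[P]_(m + n) := \matrix_(i, j) word K [:: (i, j)].

(** The inverse of [1 + gen_mx] up to terms of degree greater than [r]: the
    truncated geometric series. *)
Definition gen_mx_inv : 'M[P]_(m + n) := \sum_(k < r.+1) (- gen_mx) ^+ k.

Lemma order_gen_mx_exp k i j : order_ge k (((- gen_mx) ^+ k) i j).
Proof.
elim: k i j => [|k IHk] i j; first exact: order_ge0.
rewrite exprS mxE; apply: order_ge_sum => l; apply: (order_geM (j := 1%N) _ (IHk l j)).
by rewrite !mxE; apply: order_geN; apply: (@order_ge_word K T [:: (i, l)]).
Qed.

Lemma gen_mx_invP : (1 + gen_mx) * gen_mx_inv = 1 - (- gen_mx) ^+ r.+1.
Proof.
have := subrX1 (- gen_mx) r.+1; rewrite -/gen_mx_inv => /(congr1 -%R).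
by rewrite opprB -mulNr opprB opprK => ->.
Qed.

Lemma gen_mx_invC : gen_mx_inv * (1 + gen_mx) = (1 + gen_mx) * gen_mx_inv.
Proof.
apply: commr_sym; apply: commr_sum => k _; apply: commrX; apply: commrN.
by apply: commr_sym; apply: commrD; [apply: commr1|].
Qed.

Lemma super_comm_gen i j k l :
  super_comm rel (par i (+) par j) (word K [:: (i, j)])
    (par k (+) par l) (word K [:: (k, l)]).
Proof.
by apply: ideal_gen_incl; apply: (trunc_scomm K idx_par r (i, j) (k, l)).
Qed.

Definition subst_var (x : gl_gen m n) : P :=
  match x with
  | inl (i, j) => (1 + gen_mx) i j
  | inr (i, j) => gen_mx_inv i j
  end.

(** The entry vanishes unless [i = j], where the parity is even. *)
Lemma super_comm_delta i j e y :
  super_comm rel (par i (+) par j) ((1 : 'M[P]_(m + n)) i j) e y.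
Proof.
rewrite mxE; case: eqP => [->|_]; last exact: super_comm0.
by rewrite addbb; apply: super_comm1.
Qed.

(** The entries of the powers of [- gen_mx] inherit their parity from the
    position, since the parity of [(i, j)] is the sum of those of [(i, l)] and
    [(l, j)]; hence it is enough that [y] supercommutes with the entries of
    [gen_mx]. *)
Lemma super_comm_subst_gen x e y :
  (forall i j, super_comm rel (par i (+) par j) (word K [:: (i, j)]) e y) ->
  super_comm rel (gl_par x) (subst_var x) e y.
Proof.
move=> Xy; case: x => [[i j]|[i j]]; rewrite /gl_par /= ?mxE.
  apply: super_commD; last exact: Xy.
  by have := super_comm_delta i j e y; rewrite !mxE.
rewrite /gen_mx_inv summxE; apply: super_comm_sum => k.
elim: (k : nat) i j => [|q IHq] i j; first exact: super_comm_delta.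
rewrite exprS mxE; apply: super_comm_sum => l.
have -> : par i (+) par j = (par i (+) par l) (+) (par l (+) par j).
  by rewrite addbA addbK.
by apply: super_commM => //; rewrite !mxE; apply: super_commN.
Qed.

Lemma super_comm_subst x y :
  super_comm rel (gl_par x) (subst_var x) (gl_par y) (subst_var y).
Proof.
apply: super_comm_subst_gen => i j; apply: super_commC.
by apply: super_comm_subst_gen => k l; apply: super_comm_gen.
Qed.

Definition subst_word (w : {fmonom gl_gen m n}) : P :=
  \prod_(x <- (w : seq _)) subst_var x.

Fact subst_word_mmorphism : mmorphism subst_word.
Proof.
split=> [x y|]; rewrite /subst_word; last by rewrite fm1 big_nil.
by rewrite /mul /= fmmulE big_cat.
Qed.
HB.instance Definition _ :=
  monalg.isMultiplicative.Build _ _ subst_word subst_word_mmorphism.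

Definition gl_subst : gl_free K m n -> P := mmap (GRing.in_alg P) subst_word.
HB.instance Definition _ :=
  GRing.Additive.copy gl_subst (mmap (GRing.in_alg P) subst_word).

Fact gl_subst_monoid : monoid_morphism gl_subst.
Proof.
have [M1 M2] : multiplicative gl_subst.
  apply: commr_mmap_is_multiplicative => x w w'.
  by rewrite /GRing.comm /= mulr_algl mulr_algr.
by split.
Qed.
HB.instance Definition _ :=
  GRing.isMonoidMorphism.Build (gl_free K m n) P gl_subst gl_subst_monoid.

Lemma gl_substZ c x : gl_subst (c *: x) = c *: gl_subst x.
Proof. by rewrite /gl_subst mmapZ mulr_algl. Qed.

Lemma gl_subst_var x : gl_subst (gl_var K x) = subst_var x.
Proof. by rewrite /gl_subst mmapU /= scale1r mul1r /subst_word fmuE big_seq1. Qed.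

Lemma const_coef_subst_var x :
  const_coef (subst_var x) = ((gl_idx x).1 == (gl_idx x).2)%:R.
Proof.
case: x => [] [i j] /=; first rewrite mxE rmorphD /= [X in _ + X]const_coef_order.
- by rewrite addr0 mxE rmorph_nat.
- by rewrite mxE; apply: (@order_ge_word K T [:: (i, j)]).
rewrite summxE rmorph_sum big_ord_recl /= big1 ?addr0 => [|k _].
  by rewrite expr0 mxE rmorph_nat.
apply: const_coef_order => w w1.
by apply: (@order_gen_mx_exp (lift ord0 k)); apply: leq_trans w1 _.
Qed.

(** This puts the image of the augmentation ideal in positive degree. *)
Lemma const_coef_subst x : const_coef (gl_subst x) = free_counit x.
Proof.
rewrite /gl_subst /free_counit !mmapE rmorph_sum; apply: eq_bigr => w _ /=.
rewrite rmorphM /= const_coefZ rmorph1 mulr1; congr (_ * _).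
rewrite /subst_word /word_counit rmorph_prod.
by apply: eq_bigr => y _; apply: const_coef_subst_var.
Qed.

(** The substitution respects the relations of K[G] modulo those of the
    truncated quotient: for [C * C^-1 = 1] the defect is a power of [gen_mx]
    of exponent [r.+1], which has too high a degree. *)
Lemma gl_subst_rel x : gl_rel x -> ideal_gen rel (gl_subst x).
Proof.
case=> [{}x y|i j|i j].
- rewrite (rmorph_super_commutator gl_subst) /= !gl_subst_var.
  exact: super_comm_subst.
- rewrite rmorphB rmorph_sum rmorph_nat /=.
  under eq_bigr => k _ do rewrite rmorphM /= !gl_subst_var /=.
  have := congr1 (fun M : 'M[P]_(m + n) => M i j) gen_mx_invP.
  rewrite mxE => ->; apply/ideal_gen_incl/trunc_high.
  by rewrite mx_subr1; apply/order_geN/order_gen_mx_exp.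
- rewrite rmorphB rmorph_sum rmorph_nat /=.
  under eq_bigr => k _ do rewrite rmorphM /= !gl_subst_var /=.
  have := congr1 (fun M : 'M[P]_(m + n) => M i j) gen_mx_invP.
  rewrite -gen_mx_invC mxE => ->; apply/ideal_gen_incl/trunc_high.
  by rewrite mx_subr1; apply/order_geN/order_gen_mx_exp.
Qed.

Lemma gl_subst_ideal x : x \in gl_ideal K m n -> ideal_gen rel (gl_subst x).
Proof.
move/in_ideal_genP; elim=> [|a s b y /gl_subst_rel s0 _ y0].
  by rewrite rmorph0; apply: ideal_gen0.
by rewrite rmorphD !rmorphM /=; apply: ideal_genD; first apply: ideal_genM.
Qed.

Lemma gl_subst_prod_c s : exists2 z, order_lt (size s) z &
  gl_subst (\prod_(x <- s) gl_var K (inl x)) = word K s + z.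
Proof.
have [z zs sE] := prod_word_leading K (fun x : T => x.1 == x.2) s.
exists z => //; rewrite rmorph_prod -sE; apply: eq_bigr => -[i j] _ /=.
by rewrite gl_subst_var /= !mxE.
Qed.

(** The distribution is the substitution followed by [top_form r g].  It is
    well defined because [top_form r g] kills the relations of the truncated
    quotient; it kills the power [r.+1] of the augmentation ideal because
    elements of degree greater than [r] have no component of degree [r]; and it
    has the right values because a monomial of degree [r] in C has, after the
    substitution, the same monomial in [gen_mx] as its component of
    degree [r]. *)
Lemma super_form_distribution (g : seq T -> K) :
  (forall u v x y, size (u ++ x :: y :: v) = r ->
    g (u ++ x :: y :: v) =
      (-1) ^+ (idx_par x && idx_par y) * g (u ++ y :: x :: v)) ->
  exists2 phi : {scalar gl_coord K m n}, gl_dist K m n phi &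
    forall s, size s = r -> phi (\prod_(x <- s) gl_c K x.1 x.2) = g s.
Proof.
move=> g_swap; pose phi x := top_form r g (gl_subst (gl_repr x)).
have phi_pi u : phi (gl_pi u) = top_form r g (gl_subst u).
  (* The chosen representative and [u] differ by an element of the ideal. *)
  apply/eqP; rewrite -subr_eq0 -linearB -rmorphB; apply/eqP.
  by apply: (top_form_ideal g_swap); apply/gl_subst_ideal/gl_reprB.
have phi_lin : scalar phi.
  move=> k; elim/gl_coord_ind=> x; elim/gl_coord_ind=> y.
  by rewrite -linearP !phi_pi rmorphD /= gl_substZ linearP.
pose Phi : {scalar gl_coord K m n} :=
  HB.pack phi (GRing.isLinear.Build K (gl_coord K m n) K *%R phi phi_lin).
exists Phi => [|s sr] /=.
  exists r.+1 => x; elim=> [|a s b {}x [F F0 ->] _ IH].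
    by rewrite linear0.
  rewrite linearD IH addr0 /=.
  rewrite [X in phi X](_ : _ =
    gl_pi (gl_repr a * (\prod_i gl_repr (F i)) * gl_repr b)); last first.
    apply/esym/(etrans (rmorph_mul_prod (@gl_pi K m n) _ _ _)).
    have es : \prod_i gl_pi (gl_repr (F i)) = \prod_i F i.
      by apply: eq_bigr => i _; rewrite (gl_reprK (F i)).
    exact: (congr2 *%R (congr2 *%R (gl_reprK a) es) (gl_reprK b)).
  rewrite phi_pi; apply: top_form_high.
  rewrite (rmorph_mul_prod gl_subst); apply: order_ge_mul_prod => i.
  by apply: const_coef0_order; rewrite /= const_coef_subst; apply: F0.
have -> : \prod_(x <- s) gl_c K x.1 x.2 = gl_pi (\prod_(x <- s) gl_var K (inl x)).
  by rewrite rmorph_prod; apply: eq_bigr => -[].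
have [z zs sE] := gl_subst_prod_c s.
rewrite phi_pi sE linearD /= top_form_word sr eqxx top_form_low ?addr0 //.
by rewrite -sr.
Qed.
End TruncatedPoint.

(** * Adjacent transpositions *)

(** A transposition of two positions at distance greater than 1 is conjugate,
    by an adjacent transposition, to one at smaller distance. *)
Lemma adjacent_tperm_ind (r : nat) (Q : 'S_r -> Prop) :
  Q 1%g -> (forall s t, Q s -> Q t -> Q (s * t)%g) ->
  (forall a b : 'I_r, b = a.+1 :> nat -> Q (tperm a b)) -> forall s, Q s.
Proof.
move=> Q1 QM Qadj s.
have Qlt k (a b : 'I_r) : b = (a + k).+1 :> nat -> Q (tperm a b).
  elim: k b => [|k IHk] b bE; first by apply: Qadj; rewrite bE addn0.
  have lt_c : (a + k.+1 < r)%N by rewrite -bE ltnW // bE.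
  pose c := Ordinal lt_c.
  have -> : tperm a b = (tperm c b * tperm a c * tperm c b)%g.
    have <- : (tperm a c ^ tperm c b)%g = tperm a b.
      rewrite tpermJ tpermL tpermD // -val_eqE /= ?bE -?addnS ?eqn_add2l //;
      by rewrite -[X in _ != X]addn0 eqn_add2l.
    by rewrite /conjg tpermV mulgA.
  by apply: (QM); first apply: (QM);
    [apply: Qadj; rewrite bE|apply: IHk; rewrite /= addnS|apply: Qadj; rewrite bE].
have [ts -> dts] := prod_tpermP s; elim: ts dts => [|[a b] ts IH] /=.
  by rewrite big_nil.
case/andP=> /= ab /IH Qts; rewrite big_cons; apply: QM => //=.
have [lt_ab|lt_ba|/val_inj eq_ab] := ltngtP a b; last by rewrite eq_ab eqxx in ab.
  by apply: (Qlt (b - a.+1)%N); rewrite -addSn subnKC.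
by rewrite tpermC; apply: (Qlt (a - b.+1)%N); rewrite -addSn subnKC.
Qed.

Lemma map_enum_tperm (T : Type) r (F : 'I_r -> T) (a b : 'I_r) :
  b = a.+1 :> nat -> exists u v,
  [seq F k | k <- enum 'I_r] = u ++ F a :: F b :: v /\
  [seq F (tperm a b k) | k <- enum 'I_r] = u ++ F b :: F a :: v.
Proof.
move=> ab; pose e := enum 'I_r.
have eE : e = take a e ++ a :: b :: drop a.+2 e.
  rewrite -{1}(cat_take_drop a e) (drop_nth a) ?size_enum_ord // nth_ord_enum.
  by rewrite (drop_nth a) -ab ?size_enum_ord // nth_ord_enum ab.
have := enum_uniq 'I_r; rewrite -/e {1}eE cat_uniq => /and3P[_ no_e /= uab].
exists [seq F k | k <- take a e], [seq F k | k <- drop a.+2 e].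
rewrite -/e {1 4}eE !map_cat /= tpermL tpermR; split=> //.
move: no_e uab; rewrite /= !negb_or.
move=> /and3P[na nb _] /and3P[/andP[_ na'] nb' _].
by congr (_ ++ [:: _, _ & _]); apply/eq_in_map => k ke; rewrite tpermD //;
  apply/eqP => kE; move: ke; rewrite -kE; apply/negP.
Qed.

(** * Signs *)

Section Signs.
Variables (K : fieldType) (m n r : nat).
Implicit Types (I J : midx m n r) (a b : 'I_r).

Definition midx_swap a b I : midx m n r := [ffun k => I (tperm a b k)].

Lemma midx_swapK a b : involutive (midx_swap a b).
Proof. by move=> I; apply/ffunP=> k; rewrite !ffunE tpermK. Qed.

Lemma midx_par_swap a b I : midx_par (midx_swap a b I) = midx_par I.
Proof.
rewrite /midx_par [in RHS](reindex_inj (@perm_inj _ (tperm a b))) /=.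
by congr odd; apply: eq_bigr => k _; rewrite ffunE.
Qed.

(** An adjacent transposition preserves the order of all pairs of positions
    except the pair [(a, b)]. *)
Lemma prod_lt_swap (h : 'I_r -> 'I_r -> K) a b : b = a.+1 :> nat ->
  (\prod_(x < r) \prod_(y < r | (x < y)%N) h (tperm a b x) (tperm a b y)) * h a b =
  (\prod_(x < r) \prod_(y < r | (x < y)%N) h x y) * h b a.
Proof.
move=> ab; rewrite !pair_big_dep /=.
have swap_inj : injective (fun z : 'I_r * 'I_r => (tperm a b z.1, tperm a b z.2)).
  by move=> [x y] [x' y'] [/perm_inj-> /perm_inj->].
rewrite (reindex_inj swap_inj) /=.
under eq_bigr => z _ do rewrite !tpermK.
(* Apart from the two pairs split off, both products range over the same set. *)
rewrite (bigD1 (b, a)) /=; last by rewrite tpermL tpermR ab.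
rewrite [in RHS](bigD1 (a, b)) /=; last by rewrite ab.
rewrite mulrAC -!mulrA mulrC -!mulrA; congr (_ * _).
congr (_ * _); apply: eq_bigl => -[x y] /=.
rewrite !xpair_eqE -!val_eqE /= !permE /= -!val_eqE /=.
do 2!case: eqP; do 2!case: eqP; rewrite ?ab /=; lia.
Qed.

(** The sign relating the coefficient of [Psi r phi] at [(I, J)] to the value
    of [phi] at the monomial with letters [(I k, J k)]. *)
Definition koszul_sign I J : K :=
  (-1) ^+ (midx_par I && (midx_par I (+) midx_par J)) *
  \prod_(a < r) \prod_(b < r | (a < b)%N)
     (-1) ^+ ((par (I a) (+) par (J a)) && par (I b)).

Lemma koszul_sign2 I J : koszul_sign I J * koszul_sign I J = 1.
Proof.
rewrite /koszul_sign mulrACA -expr2 sqrr_sign mul1r -big_split big1 //= => a _.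
by rewrite -big_split big1 //= => b _; rewrite -expr2 sqrr_sign.
Qed.

Definition swap_sign a b I : K := (-1) ^+ (par (I a) && par (I b)).

(** The Koszul sign turns the sign rule for commuting with the symmetric group,
    which involves the letters of [I] and of [J] separately, into the sign rule
    for supercommuting the letters [(I a, J a)] and [(I b, J b)].  Only the
    factor of the pair [(a, b)] changes, by the exponent
    [J a I b + I a J b] in terms of parities. *)
Lemma koszul_sign_swap a b I J : b = a.+1 :> nat ->
  koszul_sign (midx_swap a b I) (midx_swap a b J) =
  (-1) ^+ ((par (I a) (+) par (J a)) && (par (I b) (+) par (J b))) *
  (swap_sign a b I * swap_sign a b J) * koszul_sign I J.
Proof.
move=> ab; rewrite /koszul_sign !midx_par_swap [RHS]mulrCA; congr (_ * _).
pose h x y : K := (-1) ^+ ((par (I x) (+) par (J x)) && par (I y)).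
have hh : h a b * h a b = 1 by rewrite -expr2 sqrr_sign.
have := prod_lt_swap h ab.
set H := \prod_(x < r) \prod_(y < r | (x < y)%N) h x y => hab.
transitivity (\prod_(x < r) \prod_(y < r | (x < y)%N) h (tperm a b x) (tperm a b y)).
  by apply: eq_bigr => x _; apply: eq_bigr => y _; rewrite !ffunE.
set H' := (LHS); have -> : H' = H' * (h a b * h a b) by rewrite hh mulr1.
rewrite mulrA hab -mulrA mulrC; congr (_ * _).
by rewrite /swap_sign /h -!signr_addb; congr (_ ^+ nat_of_bool _);
  case: (par (I a)); case: (par (I b)); case: (par (J a)); case: (par (J b)).
Qed.

End Signs.

(** * Operators and their coefficients *)

Lemma prod_swap_sign (A : nzRingType) (X : Type) (F : X -> A) (e : bool) u v x y :
  F y * F x = (-1) ^+ e * (F x * F y) ->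
  \prod_(z <- u ++ y :: x :: v) F z = (-1) ^+ e * \prod_(z <- u ++ x :: y :: v) F z.
Proof.
move=> yx; rewrite !big_cat !big_cons /= (mulrA (F y)) yx.
by rewrite !mulrA commr_sign.
Qed.

Lemma scalar_sign (K : fieldType) (A : lalgType K) (phi : {scalar A}) (e : bool) x :
  phi ((-1) ^+ e * x) = (-1) ^+ e * phi x.
Proof. by case: e; rewrite ?expr0 ?mul1r // expr1 !mulN1r linearN. Qed.

Section Coefficients.
Variables (K : fieldType) (m n r : nat).
Implicit Types (I J : midx m n r) (a b : 'I_r) (f : 'End(tens K m n r)).

Definition coef f I J : K := f (tvec K J) I.

Lemma eq_coef f f' : (forall I J, coef f I J = coef f' I J) -> f = f'.
Proof. by move=> ff'; apply: eq_lin_tvec => J; apply/ffunP=> I; apply: ff'. Qed.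

Definition letters I J : seq ('I_(m + n) * 'I_(m + n)) :=
  [seq (I k, J k) | k <- enum 'I_r].

Lemma Psi_coef (phi : {scalar gl_coord K m n}) I J : coef (Psi r phi) I J =
  koszul_sign K I J * phi (\prod_(x <- letters I J) gl_c K x.1 x.2).
Proof.
rewrite /coef /Psi lin_ext_tvec sum_ffunE (bigD1 I) //= big1 => [|L /negPf LI].
  rewrite !ffunE eqxx addr0 /tcoef linearZ /= /koszul_sign.
  rewrite big_map enumT [index_enum _]unlock.
  by rewrite /GRing.scale /= mulr1 mulrA.
by rewrite !ffunE eq_sym LI /GRing.scale /= mulr0.
Qed.

Lemma sym_op_swap a b (w : tens K m n r) I : b = a.+1 :> nat ->
  sym_op K m n (tperm a b) w (midx_swap a b I) = swap_sign K a b I * w I.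
Proof.
move=> ab; rewrite [w]tens_sum linear_sum /= sum_ffunE [in RHS]sum_ffunE mulr_sumr.
apply: eq_bigr => L _; rewrite linearZ /= sym_op_transp // !ffunE /GRing.scale /=.
rewrite (inj_eq (can_inj (midx_swapK a b))); case: eqP => [->|_]; last by rewrite !mulr0.
by rewrite !mulr1 mulrC.
Qed.

(** Commuting with the symmetric group is a condition on adjacent
    transpositions, for which it compares two coefficients at a time. *)
Lemma End_symP f : End_sym K m n r f <-> forall a b I J, b = a.+1 :> nat ->
  coef f (midx_swap a b I) (midx_swap a b J) =
  swap_sign K a b I * swap_sign K a b J * coef f I J.
Proof.
have s2 a b I : swap_sign K a b I * swap_sign K a b I = 1.
  by rewrite -expr2 sqrr_sign.
have left_coef a b I J : b = a.+1 :> nat ->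
    coef (f \o sym_op K m n (tperm a b))%VF (midx_swap a b I) J =
    swap_sign K a b J * coef f (midx_swap a b I) (midx_swap a b J).
  by move=> ab; rewrite /coef comp_lfunE sym_op_transp // linearZ /= ffunE.
have right_coef a b I J : b = a.+1 :> nat ->
    coef (sym_op K m n (tperm a b) \o f)%VF (midx_swap a b I) J =
    swap_sign K a b I * coef f I J.
  by move=> ab; rewrite /coef comp_lfunE sym_op_swap.
split=> [f_sym a b I J ab|f_swap s].
  have := right_coef a b I J ab; rewrite -f_sym left_coef // => fab.
  by rewrite mulrAC -fab mulrC mulrA s2 mul1r.
elim/adjacent_tperm_ind: s => [|s t fs ft|a b ab].
- by rewrite sym_op1 comp_lfun1l comp_lfun1r.
- have -> : sym_op K m n (s * t)%g = (sym_op K m n t \o sym_op K m n s)%VF.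
    by apply/lfunP => w; rewrite comp_lfunE sym_opM.
  by rewrite comp_lfunA ft -!comp_lfunA fs.
apply: eq_coef => I J; rewrite -(midx_swapK a b I) left_coef // right_coef //.
by rewrite f_swap // mulrA [X in X * _]mulrCA s2 mulr1.
Qed.

(** Exchanging two adjacent letters permutes two adjacent factors of the
    monomial in the entries of C, so the sign rule for the coefficients comes
    from supercommutativity. *)
Lemma schur_sub_End_sym f : schur K m n r f -> End_sym K m n r f.
Proof.
move=> [phi _ <-]; apply/End_symP => a b I J ab.
rewrite !Psi_coef koszul_sign_swap //.
have [u [v [uv]]] := map_enum_tperm (fun k => (I k, J k)) ab.
have -> : [seq (I (tperm a b k), J (tperm a b k)) | k <- enum 'I_r] =
    letters (midx_swap a b I) (midx_swap a b J).
  by apply: eq_map => k; rewrite !ffunE.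
move=> ->; rewrite /letters uv.
pose c (x : 'I_(m + n) * 'I_(m + n)) := gl_c K x.1 x.2.
have cM := gl_cM K (I b) (J b) (I a) (J a).
have phi_swap := congr1 phi (@prod_swap_sign _ _ c _ u v (I a, J a) (I b, J b) cM).
rewrite (etrans phi_swap (scalar_sign phi _ _)) andbC mulrACA [X in X * _]mulrAC.
by rewrite -expr2 sqrr_sign mul1r.
Qed.

Section FromLetters.
(* A default value for [nth]; words of length [r] never reach it. *)
Variable x0 : 'I_(m + n) * 'I_(m + n).

Definition fst_idx (s : seq ('I_(m + n) * 'I_(m + n))) : midx m n r :=
  [ffun k : 'I_r => (nth x0 s k).1].
Definition snd_idx (s : seq ('I_(m + n) * 'I_(m + n))) : midx m n r :=
  [ffun k : 'I_r => (nth x0 s k).2].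

Lemma letters_idx I J : fst_idx (letters I J) = I /\ snd_idx (letters I J) = J.
Proof.
have nthE (k : 'I_r) : nth x0 (letters I J) k = (I k, J k).
  by rewrite (nth_map k) ?size_enum_ord // nth_ord_enum.
by split; apply/ffunP=> k; rewrite ffunE nthE.
Qed.

Lemma idx_swap u v x y (a b : 'I_r) : a = size u :> nat -> b = a.+1 :> nat ->
  fst_idx (u ++ y :: x :: v) = midx_swap a b (fst_idx (u ++ x :: y :: v)) /\
  snd_idx (u ++ y :: x :: v) = midx_swap a b (snd_idx (u ++ x :: y :: v)).
Proof.
move=> au ab.
have nthE (k : 'I_r) : nth x0 (u ++ y :: x :: v) k =
    nth x0 (u ++ x :: y :: v) (tperm a b k).
  have [->|ka] := eqVneq k a.
    by rewrite tpermL ab au !nth_cat ltnn ltnNge leqnSn subnn subSnn.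
  have [->|kb] := eqVneq k b.
    by rewrite tpermR ab au !nth_cat ltnn ltnNge leqnSn subnn subSnn.
  rewrite tpermD 1?eq_sym // !nth_cat; case: ltnP => // uk.
  move: ka kb; rewrite -!val_eqE /= ab au -{1 2}(subnKC uk).
  by case: (k - size u)%N => [|[|d]] //=; rewrite ?addn0 ?addn1 eqxx.
by split; apply/ffunP=> k; rewrite !ffunE nthE.
Qed.

(** The coefficients of [f], multiplied by their Koszul signs, form a
    supersymmetric function of the letters, to which
    [super_form_distribution] applies. *)
Lemma End_sym_sub_schur f : End_sym K m n r f -> schur K m n r f.
Proof.
move=> /End_symP f_swap.
pose g s := koszul_sign K (fst_idx s) (snd_idx s) * coef f (fst_idx s) (snd_idx s).
have g_swap u v x y : size (u ++ x :: y :: v) = r -> g (u ++ x :: y :: v) =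
    (-1) ^+ (idx_par x && idx_par y) * g (u ++ y :: x :: v).
  move=> sz; have lt_b : ((size u).+1 < r)%N.
    by rewrite -sz size_cat /= !addnS !ltnS leq_addr.
  pose a := Ordinal (ltnW lt_b); pose b := Ordinal lt_b.
  have [IE JE] := @idx_swap u v x y a b erefl erefl.
  rewrite /g IE JE koszul_sign_swap // f_swap //.
  have Ia : fst_idx (u ++ x :: y :: v) a = x.1 by rewrite ffunE nth_cat ltnn subnn.
  have Ja : snd_idx (u ++ x :: y :: v) a = x.2 by rewrite ffunE nth_cat ltnn subnn.
  have Ib : fst_idx (u ++ x :: y :: v) b = y.1.
    by rewrite ffunE nth_cat ltnNge leqnSn subSnn.
  have Jb : snd_idx (u ++ x :: y :: v) b = y.2.
    by rewrite ffunE nth_cat ltnNge leqnSn subSnn.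
  rewrite Ia Ja Ib Jb /idx_par; set S := swap_sign _ _ _ _ * _.
  have SS : S * S = 1 by rewrite /S /swap_sign mulrACA -!expr2 !sqrr_sign mulr1.
  set c := koszul_sign _ _ _; clearbody S c.
  by rewrite -!mulrA signrMK [RHS]mulrCA [in RHS](mulrA S) SS mul1r.
have [phi phi_dist phiE] := super_form_distribution g_swap.
exists phi => //; apply: eq_coef => I J.
rewrite Psi_coef phiE /g; last by rewrite size_map size_enum_ord.
have [-> ->] := letters_idx I J.
by rewrite mulrA koszul_sign2 mul1r.
Qed.
End FromLetters.

End Coefficients.

Local Open Scope classical_set_scope.

Theorem proposition4p1 (K : fieldType) (m n r : nat)
    (K_infinite : infinite_set [set: K])
    (mn_gt0 : (0 < m + n)%N) (r_gt0 : (0 < r)%N) :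
  schur K m n r = End_sym K m n r.
Proof.
pose i0 := Ordinal mn_gt0.
apply/seteqP; split=> f; first exact: schur_sub_End_sym.
exact: (@End_sym_sub_schur _ _ _ _ (i0, i0)).
Qed.
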